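(* There exist a Banach space $X$ and $T_1,T_2\in\mathfrak L(X)$ such that $(T_1,T_2)$ is $d$-frequently hypercyclic but not densely $d$-hypercyclic.
   Context: $(T_1,T_2)$ is $d$-frequently hypercyclic if there is $x\in X$ such that for every non-empty open $W\subset X\times X$ the set $\{n\in\mathbb N:(T_1^nx,T_2^nx)\in W\}$ has positive lower density. A vector $x$ is $d$-hypercyclic for $(T_1,T_2)$ if $\{(T_1^nx,T_2^nx):n\ge0\}$ is dense in $X\times X$; the pair is densely $d$-hypercyclic if the set of $d$-hypercyclic vectors is dense in $X$. *)

(* Defs.v *)
From HB Require Import structures.
From mathcomp Require Import all_boot all_order all_algebra.
From mathcomp Require Import all_classical all_reals all_analysis.
From mathcomp Require Import Rstruct Rstruct_topology.
Set Implicit Arguments. Unset Strict Implicit. Unset Printing Implicit Defensive.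
Import Order.TTheory GRing.Theory Num.Theory.
Local Open Scope classical_set_scope.
Local Open Scope ring_scope.

Definition count_below (A : set nat) (N : nat) : nat :=
  \sum_(n < N) (if `[< A n >] then 1%N else 0%N).

(* A has positive lower density: liminf_N #(A ∩ [0,N)) / N > 0,
   written as: there is c > 0 with #(A ∩ [0,N)) >= c N for all large N. *)
Definition pos_lower_density (A : set nat) : Prop :=
  exists2 c : Rdefinitions.R, 0 < c &
    \forall N \near \oo, c * N%:R <= (count_below A N)%:R.

Definition d_freq_hypercyclic (X : topologicalType) (T1 T2 : X -> X) : Prop :=
  exists x : X, forall W : set (X * X), open W -> W !=set0 ->
    pos_lower_density [set n | W (iter n T1 x, iter n T2 x)].

Definition d_hypercyclic_vector (X : topologicalType) (T1 T2 : X -> X) (x : X) : Prop :=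
  dense [set (iter n T1 x, iter n T2 x) | n in [set: nat]].

Definition densely_d_hypercyclic (X : topologicalType) (T1 T2 : X -> X) : Prop :=
  dense [set x | d_hypercyclic_vector T1 T2 x].

(* Main.v *)
(** On [c_0] let [T] be four times the backward shift. Choose [(x, w)] frequently
    hypercyclic for [T (+) T], with [x_0 = 1] and [x_1 = w_0 = w_1 = 0], and a
    vector [u] with [u_0 = u_1 = 0] whose orbit under [T] grows faster than that
    of [w]. Then [S v = v + v_0 w + v_1 u] is invertible, and [T_1 = T],
    [T_2 = S^-1 T S] work. Up to the homeomorphism [(a, b) |-> (a, S b - a)], the
    joint orbit of [v] is [(T^n v, T^n (v_0 w + v_1 u))]. For [v = x] this is
    [(T^n x, T^n w)], whereas if [v_1 <> 0] its second component stays away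
    from [0]: no [d]-hypercyclic vector lies in the open set [v_1 <> 0]. *)
Require Import Defs.
From HB Require Import structures.
From mathcomp Require Import all_boot all_order all_algebra.
From mathcomp Require Import all_classical all_reals all_analysis.
From mathcomp Require Import Rstruct Rstruct_topology.
From mathcomp Require Import zify ring lra.
Set Implicit Arguments. Unset Strict Implicit. Unset Printing Implicit Defensive.
Import Order.TTheory GRing.Theory Num.Theory.
Import numFieldNormedType.Exports.
Local Open Scope classical_set_scope.
Local Open Scope ring_scope.

(** * The Banach space of null sequences *)

Section C0.
Variable R : realType.

Definition null_seq : {pred nat -> R} := fun x => `[< x @ \oo --> (0 : R) >].

Lemma null_seqP (x : nat -> R) :
  reflect (x @ \oo --> (0 : R)) (x \in null_seq).
Proof. exact: asboolP. Qed.

Fact null_seq_submod : submod_closed null_seq.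
Proof.
split => [|a x y /null_seqP x0 /null_seqP y0]; apply/null_seqP.
  exact: cvg_cst.
by have := cvgD (cvgM (cvg_cst a) x0) y0; rewrite mulr0 addr0; apply.
Qed.

HB.instance Definition _ :=
  GRing.isSubmodClosed.Build R (nat -> R) null_seq null_seq_submod.

Record c0 := C0 { c0_val :> nat -> R; c0P : c0_val \in null_seq }.
HB.instance Definition _ := [isSub for c0_val].
HB.instance Definition _ := [Choice of c0 by <:].
HB.instance Definition _ := [SubChoice_isSubLmodule of c0 by <:].

Lemma c0_ext (x y : c0) : (forall n, x n = y n) -> x = y.
Proof. by move=> xy; apply/val_inj/funext. Qed.

Lemma c0_cvg (x : c0) : x n @[n --> \oo] --> (0 : R).
Proof. exact/null_seqP/c0P. Qed.

Definition c0_norm (x : c0) : R := sup (range (fun n => `|x n|)).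

Lemma c0_has_sup (x : c0) : has_sup (range (fun n => `|x n|)).
Proof.
split; first by exists `|x 0|; exists 0.
have /cvgP/cvg_seq_bounded[M [_ Mx]] := c0_cvg x.
by exists (M + 1) => _ [n _ <-]; apply: Mx; rewrite ?ltrDl.
Qed.

Lemma c0_norm_ub (x : c0) n : `|x n| <= c0_norm x.
Proof. by apply: sup_upper_bound; [exact: c0_has_sup|exists n]. Qed.

Lemma c0_norm_le (x : c0) e : (forall n, `|x n| <= e) -> c0_norm x <= e.
Proof.
move=> xe; apply: ge_sup; first by exists `|x 0|; exists 0.
by move=> _ [n _ <-].
Qed.

Lemma c0_normD (x y : c0) : c0_norm (x + y) <= c0_norm x + c0_norm y.
Proof.
by apply: c0_norm_le => n; rewrite (le_trans (ler_normD _ _))// lerD ?c0_norm_ub.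
Qed.

Lemma c0_normZ (a : R) (x : c0) : c0_norm (a *: x) = `|a| * c0_norm x.
Proof.
apply/eqP; rewrite eq_le; apply/andP; split.
  by apply: c0_norm_le => n; rewrite normrM ler_wpM2l ?c0_norm_ub.
have [->|a0] := eqVneq a 0.
  by rewrite normr0 mul0r (le_trans _ (c0_norm_ub _ 0)).
rewrite mulrC -ler_pdivlMr ?normr_gt0//; apply: c0_norm_le => n.
by rewrite ler_pdivlMr ?normr_gt0// mulrC -normrM; exact: (c0_norm_ub (a *: x)).
Qed.

Lemma c0_norm_eq0 (x : c0) : c0_norm x = 0 -> x = 0.
Proof.
move=> x0; apply: c0_ext => n; apply/eqP.
by rewrite -normr_le0 -x0 c0_norm_ub.
Qed.

HB.instance Definition _ := Lmodule_isNormed.Build R c0 c0_normD c0_normZ c0_norm_eq0.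

Lemma c0_coord_dist (x y : c0) n : `|x n - y n| <= `|x - y|.
Proof. exact: (c0_norm_ub (x - y)). Qed.

(** The limit is built coordinate by coordinate, using completeness of the scalars. *)
Lemma c0_cauchy_cvg (F : set_system c0) : ProperFilter F -> cauchy F -> cvg F.
Proof.
move=> FF Fc.
have Fball (e : R) : 0 < e -> exists x : c0, F [set y : c0 | `|x - y| < e].
  move=> e0; have /cauchyP/(_ _ e0)[x Fx] := Fc.
  by exists x; apply: filterS Fx => y; rewrite -ball_normE.
pose g n (x : c0) : R := x n.
have gcvg n : cvg (g n @ F).
  apply: cauchy_cvg; apply: cauchy_exP => e /Fball[x Fx].
  exists (x n); change (F (g n @^-1` ball (x n) e)).
  apply: filterS Fx => y xy; rewrite /= -ball_normE/=.
  by apply: le_lt_trans xy; exact: c0_coord_dist.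
pose l n := lim (g n @ F).
(* A bound around one centre [x] passes to the limit with the same [e] in every coordinate; this
   uniformity gives both that [l] is null and that [F] converges in norm. *)
have lP (e : R) (x : c0) : F [set y : c0 | `|x - y| < e] ->
    forall n, `|x n - l n| <= e.
  move=> Fx n.
  have h : (fun y : c0 => `|x n - g n y|) @ F --> `|x n - l n|.
    by apply: cvg_norm; apply: cvgB; [exact: cvg_cst|exact: gcvg].
  rewrite -(cvg_lim _ h)//; apply: limr_le; first by apply/cvg_ex; eexists; exact: h.
  apply: filterS Fx => y xy; apply: ltW; apply: le_lt_trans xy.
  exact: c0_coord_dist.
have l0 : l \in null_seq.
  apply/null_seqP/cvgrPdist_le => e e0.
  have e2 : 0 < e / 2 by rewrite divr_gt0.
  have [x /lP xl] := Fball _ e2.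
  have /cvgrPdist_le/(_ _ e2) := c0_cvg x.
  apply: filterS => n; rewrite !sub0r !normrN => xn.
  have := xl n; rewrite distrC => {}xl.
  rewrite (splitr e) -(subrK (x n) (l n)).
  by apply: le_trans (ler_normD _ _) _; exact: lerD.
apply/cvg_ex; exists (C0 l0 : c0); apply/cvgrPdist_le => e e0.
have e2 : 0 < e / 2 by rewrite divr_gt0.
have [x Fx] := Fball _ e2; have xl := lP _ _ Fx.
near_simpl; apply: filterS Fx => y xy.
apply: c0_norm_le => n; rewrite -[X in `|X|]/(l n - y n) (splitr e) -(subrKA (x n)).
apply: le_trans (ler_normD _ _) _; apply: lerD; first by rewrite distrC.
by apply: ltW; apply: le_lt_trans xy; exact: c0_coord_dist.
Qed.

HB.instance Definition _ := Uniform_isComplete.Build c0 c0_cauchy_cvg.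

(** * The shift and its perturbation *)

Lemma c0E : (forall (x y : c0) n, (x + y) n = x n + y n) *
  (forall a (x : c0) n, (a *: x) n = a * x n) *
  (forall (x : c0) n, (- x) n = - x n).
Proof. by []. Qed.

Lemma c0_dist_le (x y : c0) e : (forall n, `|x n - y n| <= e) -> `|x - y| <= e.
Proof. exact: (@c0_norm_le (x - y)). Qed.

Lemma c0_coord_continuous n : continuous (fun x : c0 => x n).
Proof.
move=> x; apply/(@cvgrPdist_lt _ _ _ (nbhs x) (nbhs_filter x)) => e e0.
near=> y; apply: le_lt_trans (c0_coord_dist _ _ _) _.
by near: y; exact: cvgr_dist_lt.
Unshelve. all: by end_near. Qed.

Fact shift_null (x : c0) : (fun n => 4 * x n.+1) \in null_seq.
Proof.
apply/null_seqP; have := c0_cvg x; rewrite -cvg_shiftS => x0.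
by have := cvgM (cvg_cst (4 : R)) x0; rewrite mulr0; apply.
Qed.

Definition bshift (x : c0) : c0 := C0 (shift_null x).

Fact bshift_linear : linear bshift.
Proof.
by move=> a x y; apply: c0_ext => n; rewrite /= mulrDr; congr (_ + _); rewrite mulrCA.
Qed.
HB.instance Definition _ := GRing.isLinear.Build R c0 c0 *:%R bshift bshift_linear.

Lemma bshift_continuous : continuous bshift.
Proof.
apply/linear_bounded_continuous/linear_boundedP; near=> M.
move=> x; apply: c0_norm_le => n /=; rewrite normrM.
by rewrite ler_pM// ?(c0_norm_ub x) ?[`|4|]ger0_norm//; near: M; exact: nbhs_pinfty_ge.
Unshelve. all: by end_near. Qed.

Lemma iter_bshiftE n (x : c0) j : iter n bshift x j = 4 ^+ n * x (n + j)%N.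
Proof.
elim: n j => [|n IH] j; first by rewrite mul1r.
by rewrite iterS /= IH addnS mulrA -exprS.
Qed.

Section Perturbation.
Variables (u w : c0).

Definition perturb (v : c0) : c0 := v + v 0 *: w + v 1 *: u.

Fact perturb_linear : linear perturb.
Proof.
by move=> a x y; apply: c0_ext => n; rewrite /perturb !c0E; ring.
Qed.
HB.instance Definition _ := GRing.isLinear.Build R c0 c0 *:%R perturb perturb_linear.

Lemma perturb_continuous : continuous perturb.
Proof.
move=> x; apply: (@cvgD _ _ _ (nbhs x) (nbhs_filter x)).
  apply: (@cvgD _ _ _ (nbhs x) (nbhs_filter x)); first exact: cvg_id.
  by apply: (@cvgZr_tmp _ _ _ (nbhs x) (nbhs_filter x)); exact: c0_coord_continuous.
by apply: (@cvgZr_tmp _ _ _ (nbhs x) (nbhs_filter x)); exact: c0_coord_continuous.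
Qed.

End Perturbation.

(** The rank-two part of [perturb] takes values in sequences vanishing at 0 and 1, where it reads
    its input. Hence it squares to zero, and changing its sign inverts the map. *)
Lemma perturbK (u w : c0) : u 0 = 0 -> u 1 = 0 -> w 0 = 0 -> w 1 = 0 ->
  cancel (perturb u w) (perturb (- u) (- w)).
Proof.
move=> u0 u1 w0 w1 v; rewrite /perturb.
have E : forall i, u i = 0 -> w i = 0 -> (v + v 0 *: w + v 1 *: u : c0) i = v i.
  by move=> i ui wi; rewrite !c0E ui wi !mulr0 !addr0.
by rewrite !E// !scalerN addrAC addrK addrK.
Qed.

End C0.

(** * Positions of positive lower density *)

Section Blocks.
Local Open Scope nat_scope.

(** The 2-adic valuation takes the value [l] on all odd multiples of [2 ^ l], a set of positive
    density, while its mean stays bounded. *)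
Definition ruler (k : nat) : nat := logn 2 k.

(* The starting position of the [k]-th block. The gap between blocks [i < j] exceeds
   [ruler i + ruler j], yet [block] grows linearly, so the blocks carrying a given
   ruler value still have positive lower density. *)
Fixpoint block (k : nat) : nat :=
  if k is k'.+1 then block k' + ruler k' + ruler k + 3 else 2.

(** The extra term [k %/ 2 ^ n] is at least twice the next quotient, so it pays for both the new
    summand and the new extra term. *)
Lemma sum_divn_le k n : \sum_(1 <= i < n.+1) k %/ 2 ^ i + k %/ 2 ^ n <= k.
Proof.
elim: n => [|n IH]; first by rewrite big_geq ?divn1.
rewrite big_nat_recr//= (leq_trans _ IH)// -addnA leq_add2l expnSr divnMA.
lia.
Qed.

(** Legendre's formula: the sum is the 2-adic valuation of the factorial of [k]. *)
Lemma sum_ruler_le k : \sum_(i < k.+1) ruler i <= k.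
Proof.
suff -> : \sum_(i < k.+1) ruler i = logn 2 k`!.
  rewrite logn_fact// (leq_trans _ (sum_divn_le k k))//; exact: leq_addr.
elim: k => [|k IH]; first by rewrite big_ord1 /ruler logn0 logn1.
by rewrite big_ord_recr IH factS lognM ?fact_gt0// addnC.
Qed.

Lemma block_le k : block k <= 5 * k.+1.
Proof.
(* Consecutive gaps share a ruler value; with the last one added, each is counted at most twice and
   the induction closes. *)
suff : block k + ruler k <= 2 + 3 * k + 2 * \sum_(i < k.+1) ruler i.
  have := sum_ruler_le k; lia.
elim: k => [|k IH]; first by rewrite big_ord1.
rewrite big_ord_recr /=; move: IH; set S := \sum_(i < _) _.
move: (ruler k.+1) (ruler k) (block k); lia.
Qed.

Lemma block_ge k : 3 * k + 2 <= block k.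
Proof. by elim: k => //= k; lia. Qed.

Lemma ruler_le k : ruler k <= k.
Proof. by case: k => // k; apply/ltnW/ltn_logl. Qed.

Lemma ruler_block k : 3 * ruler k <= block k.
Proof. have := ruler_le k; have := block_ge k; lia. Qed.

Lemma block_mono : {mono block : i j / i <= j}.
Proof.
apply: leq_mono; apply: homo_ltn => [|i /=]; [exact: ltn_trans|lia].
Qed.

(** In [concat_near], [ruler j] absorbs the size [4 ^+ ruler j] of the data in the later block, and
    [ruler i] remains as the error [4 ^- ruler i]. *)
Lemma block_gap i j : i < j -> block i + ruler i + ruler j < block j.
Proof.
case: j => //= j; rewrite ltnS leq_eqVlt => /predU1P[->|ij]; first by lia.
have := block_mono i.+1 j; rewrite ij /=; lia.
Qed.

Lemma block_exists m : 1 < m -> exists k, block k <= m < block k.+1.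
Proof.
elim: m => [//|m IH]; rewrite ltnS leq_eqVlt => /predU1P[<-|/IH[k /andP[km mk]]].
  by exists 0.
have [mk'|km'] := ltnP m.+1 (block k.+1); first by exists k; rewrite mk' leqW.
exists k.+1; rewrite km' (leq_ltn_trans mk)//=; lia.
Qed.

Lemma block_mono_lt i j : (block i < block j) = (i < j).
Proof. exact: leqW_mono block_mono i j. Qed.

Lemma block_unique i j m : block i <= m < block i.+1 ->
  block j <= m < block j.+1 -> i = j.
Proof.
move=> /andP[im mi] /andP[jm mj]; apply/eqP.
rewrite eqn_leq -(ltnS i) -(ltnS j).
rewrite -(block_mono_lt i) -(block_mono_lt j).
by rewrite (leq_ltn_trans im mj) (leq_ltn_trans jm mi).
Qed.

Lemma ruler_odd_mul l i : ruler (2 ^ l * (2 * i + 1)) = l.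
Proof.
rewrite /ruler lognM ?expn_gt0 ?addn1// pfactorK//.
by rewrite logn_coprime ?addn0// coprime2n /= mul2n odd_double.
Qed.

End Blocks.

(** For [i < N.-1 %/ D] the distinct points [q i] are at most [N.-1], so they all count below
    [N]. *)
Lemma pos_lower_density_inj (A : set nat) (q : nat -> nat) (D : nat) :
  injective q -> (forall i, q i <= D * i.+1)%N -> (forall i, A (q i)) ->
  pos_lower_density A.
Proof.
move=> qI qD qA.
have D0 : (0 < D)%N.
  have := qD 0%N; have := qD 1%N; case: D {qD} => // /[!mul0n]; rewrite !leqn0.
  by move=> /eqP q1 /eqP q0; have := qI 1%N 0%N (etrans q1 (esym q0)).
have count_ge N : ((N.-1 %/ D) <= count_below A N)%N.
  case: N => [|N]; first by rewrite div0n.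
  rewrite /= /count_below -(big_mkcond (fun n : 'I_N.+1 => `[< A n >]) (fun=> 1%N)).
  rewrite sum1_card.
  pose h (i : 'I_(N %/ D)) : 'I_N.+1 := inord (q i).
  have qN (i : 'I_(N %/ D)) : (q i < N.+1)%N.
    by rewrite ltnS (leq_trans (qD _))// mulnC -leq_divRL.
  have hI : injective h.
    move=> i j /(congr1 val); rewrite /= !inordK// => /qI ij; exact: val_inj.
  rewrite -[leqLHS]card_ord -(fintype.card_image hI) subset_leq_card//.
  apply/fintype.subsetP => _ /fintype.imageP[i _ ->].
  by rewrite unfold_in inordK//; exact/asboolP.
(* The factor 4 absorbs the rounding in [N.-1 %/ D] once [4 * D <= N]. *)
exists (4 * D%:R)^-1; first by rewrite invr_gt0 mulr_gt0// ltr0n.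
near=> N.
have ND : (4 * D <= N)%N by near: N; exact: nbhs_infty_ge.
rewrite mulrC ler_pdivrMr ?mulr_gt0 ?ltr0n//.
rewrite -!natrM ler_nat (leq_trans _ (leq_mul (count_ge N) (leqnn _)))//.
have := divn_eq N.-1 D; have := ltn_pmod N.-1 D0.
set q0 := (N.-1 %/ D)%N; set r := (N.-1 %% D)%N => rD Nq.
have : (0 < q0)%N by rewrite divn_gt0//; lia.
nia.
Unshelve. all: by end_near. Qed.

(** * A frequently hypercyclic pair *)

(* Positions 0 and 1 belong to no block: there [get] returns a junk value. *)
Definition block_index (m : nat) : nat :=
  get [set k | (block k <= m < block k.+1)%N].

Lemma block_indexP m : (1 < m)%N ->
  (block (block_index m) <= m < block (block_index m).+1)%N.
Proof. by move=> /block_exists; exact: getPex. Qed.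

Section Concat.
Variables (R : realType) (y : nat -> nat -> R).
Hypothesis y_le : forall l j, `|y l j| <= 4 ^+ l.
Hypothesis y_supp : forall l j, (l < j)%N -> y l j = 0.

(* Scaled so that [T ^ (block k)] moves a copy of [y (ruler k)] to the origin. *)
Definition concat (m : nat) : R :=
  if (m < 2)%N then 0 else
  4 ^- block (block_index m) * y (ruler (block_index m)) (m - block (block_index m)).

Lemma concatE k m : (block k <= m < block k.+1)%N ->
  concat m = 4 ^- block k * y (ruler k) (m - block k).
Proof.
move=> km; have m1 : (1 < m)%N by have := block_ge k; move: km; lia.
by rewrite /concat ltnNge m1 /= (block_unique (block_indexP m1) km).
Qed.

(** On the support of block [k], [m <= block k + ruler k], so [m + 2 * ruler k <= 2 * block k] by
    [ruler_block]. The rate serves twice: it puts [concat] in [c0], and it bounds the growth of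
    coordinate 0 along its orbit by [2 ^+ n]. *)
Lemma concat_le m : `|concat m| <= 2^-1 ^+ m.
Proof.
have [m1|m1] := ltnP m 2; first by rewrite /concat m1 normr0 exprn_ge0.
have km := block_indexP m1; move: (block_index m) km => k km.
rewrite (concatE km); have [h|h] := ltnP (ruler k) (m - block k).
  by rewrite y_supp// mulr0 normr0 exprn_ge0.
rewrite normrM ger0_norm ?invr_ge0 ?exprn_ge0//.
apply: le_trans (ler_wpM2l _ (y_le _ _)) _; first by rewrite invr_ge0 exprn_ge0.
rewrite mulrC ler_pdivrMr ?exprn_gt0// exprVn mulrC ler_pdivlMr ?exprn_gt0//.
have -> : 4 = 2 ^+ 2 :> R by rewrite -natrX.
rewrite -!exprM -exprD ler_weXn2l ?ler1n//.
by have := ruler_block k; move: km h; lia.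
Qed.

(** Inside block [k] the difference is zero. Beyond it [y (ruler k) j] vanishes, and a later block
    [i] contributes at most [4 ^+ (block k + ruler i)] divided by [4 ^+ block i], which [block_gap]
    controls. *)
Lemma concat_near k j :
  `|4 ^+ block k * concat (block k + j) - y (ruler k) j| <= 4 ^- ruler k.
Proof.
have [h|h] := ltnP (block k + j) (block k.+1).
  rewrite (@concatE k) ?leq_addr// addKn mulrA divff ?mul1r ?subrr ?normr0 ?expf_neq0//.
have k1 : (1 < block k + j)%N by have := block_ge k; lia.
have := block_indexP k1; move: (block_index _) => i ki.
have ik : (k < i)%N.
  rewrite -(ltnS k.+1) -(block_mono_lt k.+1 i.+1).
  by case/andP: ki => _; exact: leq_ltn_trans.
rewrite (concatE ki) [X in _ - X]y_supp; last by move: h => /=; lia.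
rewrite subr0 mulrA normrM ger0_norm ?divr_ge0 ?exprn_ge0//.
apply: le_trans (ler_wpM2l _ (y_le _ _)) _; first by rewrite divr_ge0 ?exprn_ge0.
rewrite mulrAC ler_pdivrMr ?exprn_gt0// [leRHS]mulrC ler_pdivlMr ?exprn_gt0//.
rewrite -!exprD ler_weXn2l ?ler1n//.
by have := block_gap ik; lia.
Qed.

Fact concat_null : concat \in @null_seq R.
Proof.
apply/null_seqP/norm_cvg0P; apply: (@squeeze_cvgr _ _ _ _ (fun=> 0) (fun m => 2^-1 ^+ m)).
- by apply: nearW => m; rewrite normr_ge0 concat_le.
- exact: cvg_cst.
- by apply: cvg_expr; rewrite ger0_norm ?invf_lt1 ?ltr1n.
Qed.

Definition concat_c0 : c0 R := C0 concat_null.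

Lemma concat_c0_near k (a : c0 R) e :
  (forall j, `|y (ruler k) j - a j| <= e) ->
  `|iter (block k) (@bshift R) concat_c0 - a| <= 4 ^- ruler k + e.
Proof.
move=> ya; apply: c0_dist_le => j; rewrite iter_bshiftE.
rewrite -(subrKA (y (ruler k) j)); apply: le_trans (ler_normD _ _) _.
by apply: lerD; [exact: concat_near|exact: ya].
Qed.

End Concat.

(** * Coding of rational targets *)

Section Targets.
Variable R : realType.

(** Zeroing the offending entries enforces the hypotheses [y_le] and [y_supp] of [concat], whatever
    list is decoded. *)
Definition truncate (s : seq rat) (l j : nat) : R :=
  if (j <= l)%N && (`|ratr s`_j| <= 4 ^+ l :> R) then ratr s`_j else 0.

Lemma truncate_le s l j : `|truncate s l j| <= 4 ^+ l.
Proof. by rewrite /truncate; case: ifP => [/andP[]//|_]; rewrite normr0 exprn_ge0. Qed.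

Lemma truncate_supp s l j : (l < j)%N -> truncate s l j = 0.
Proof. by move=> lj; rewrite /truncate leqNgt lj. Qed.

(* Coding through [logn 3] makes each pair occur for arbitrarily large [l], hence
   eventually untouched by [truncate]. *)
Definition decode (l : nat) : seq rat * seq rat :=
  odflt ([::], [::]) (unpickle (logn 3 l)).

Lemma decode_surj (st : seq rat * seq rat) M :
  exists2 l, (M <= l)%N & decode l = st.
Proof.
(* The power of 2 makes [l] large without changing its 3-adic valuation. *)
exists (2 ^ M * 3 ^ pickle st)%N.
  by rewrite (leq_trans (ltnW (ltn_expl M (ltnSn 1))))// leq_pmulr// expn_gt0.
rewrite /decode lognM ?expn_gt0// pfactorK// logn_coprime ?add0n ?pickleK//.
by rewrite coprimeXr.
Qed.

(** A finite list suffices: past some index [a] is within [e] of 0, the default value of [nth]. *)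
Lemma rat_approx (a : c0 R) e : 0 < e -> exists s : seq rat,
  forall j, `|ratr s`_j - a j| <= e.
Proof.
move=> e0.
have [N _ aN] : \forall n \near \oo, `|a n| <= e.
  have /cvgrPdist_le/(_ _ e0) := c0_cvg a.
  by apply: filterS => n; rewrite sub0r normrN.
have r j : exists q : rat, `|ratr q - a j| <= e.
  have [q _] : exists2 q : rat, True & ratr q \in `]a j - e, a j + e[.
    have [|q qI] := @rat_in_itvoo R (a j - e) (a j + e); first by lra.
    by exists q.
  rewrite in_itv/= => /andP[q1 q2]; exists q.
  by rewrite ler_norml; apply/andP; split; lra.
have [f fP] := choice r.
exists (mkseq f N) => j; have [jN|Nj] := ltnP j N; first by rewrite nth_mkseq.
by rewrite nth_default ?size_mkseq// rmorph0 sub0r normrN; exact: aN.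
Qed.

Lemma natr_le_exp4 n : n%:R <= 4 ^+ n :> R.
Proof. by rewrite -natrX ler_nat ltnW// ltn_expl. Qed.

Lemma truncate_approx (a : c0 R) e : 0 < e -> exists s M,
  forall l, (M <= l)%N -> forall j, `|truncate s l j - a j| <= e.
Proof.
move=> e0; have [s sa] := rat_approx a e0.
(* The first bound keeps all listed positions; the second makes [4 ^+ l] exceed every entry, these
   being at most [|a| + e] in absolute value. *)
pose M := maxn (size s) (Num.bound (`|a| + e)).
exists s, M => l Ml j.
suff -> : truncate s l j = ratr s`_j by exact: sa.
rewrite /truncate; have [jl|lj] := leqP j l; last first.
  rewrite nth_default ?rmorph0//.
  by move: Ml; rewrite geq_max => /andP[sl _]; rewrite (leq_trans sl)// ltnW.
rewrite (_ : _ <= _)//=; apply: (@le_trans _ _ (`|a| + e)).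
  rewrite addrC -lerBlDr; apply: le_trans (sa j); apply: le_trans (lerB_dist _ _).
  by rewrite lerD2l lerN2; exact: c0_norm_ub.
apply: le_trans (natr_le_exp4 l).
apply: le_trans (ltW (archi_boundP _)) _; first by rewrite addr_ge0// ltW.
by move: Ml; rewrite geq_max ler_nat => /andP[].
Qed.

Lemma decode_approx (a b : c0 R) e : 0 < e -> exists l,
  [/\ 4 ^- l <= e, forall j, `|truncate (decode l).1 l j - a j| <= e &
      forall j, `|truncate (decode l).2 l j - b j| <= e].
Proof.
move=> e0; have [s [M sa]] := truncate_approx a e0.
have [t [N tb]] := truncate_approx b e0.
have [l] := decode_surj (s, t) (maxn M (maxn N (Num.bound e^-1))).
rewrite !geq_max => /and3P[Ml Nl el] dl; exists l; rewrite dl; split => /=.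
- rewrite -[leRHS]invrK lef_pV2 ?posrE ?exprn_gt0 ?invr_gt0//.
  apply: le_trans (natr_le_exp4 l).
  apply: le_trans (ltW (archi_boundP _)) _; first by rewrite invr_ge0 ltW.
  by rewrite ler_nat.
- exact: sa.
- exact: tb.
Qed.

End Targets.

(** * The vectors [x], [w] and [u] *)

Section Vectors.
Variable R : realType.

Definition first_blocks : c0 R :=
  concat_c0 (fun l => @truncate_le R (decode l).1 l)
    (fun l => @truncate_supp R (decode l).1 l).

Definition second_blocks : c0 R :=
  concat_c0 (fun l => @truncate_le R (decode l).2 l)
    (fun l => @truncate_supp R (decode l).2 l).

(** Both vectors use the same blocks and [l] codes a pair of targets, so one time [block k] serves
    both: this is frequent hypercyclicity of the direct sum of two copies of the shift. *)
Lemma blocks_approx (a b : c0 R) e : 0 < e -> exists l, forall k, ruler k = l ->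
  `|iter (block k) (@bshift R) first_blocks - a| <= e /\
  `|iter (block k) (@bshift R) second_blocks - b| <= e.
Proof.
move=> e0; have e2 : 0 < e / 2 by rewrite divr_gt0.
have [l [le la lb]] := decode_approx a b e2; exists l => k kl.
rewrite (splitr e); split.
  apply: le_trans (concat_c0_near _ _ (a := a) (e := e / 2) _) _; first by rewrite kl.
  by rewrite lerD2r kl.
apply: le_trans (concat_c0_near _ _ (a := b) (e := e / 2) _) _; first by rewrite kl.
by rewrite lerD2r kl.
Qed.

Fact basis_null k : (fun n : nat => (n == k)%:R) \in @null_seq R.
Proof.
apply/null_seqP/cvgrPdist_le => e e0; exists k.+1 => // n /= nk.
by rewrite sub0r normrN gtn_eqF// normr0 ltW.
Qed.
Definition basis k : c0 R := C0 (basis_null k).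

(** Coordinate 0 of the orbit of this sequence grows like [3 ^+ n], against at most [2 ^+ n] for
    [second_blocks]. The two leading zeros are those required by [perturbK]. *)
Fact slow_null : (fun n : nat => if (n < 2)%N then 0 else (3 / 4) ^+ n) \in @null_seq R.
Proof.
apply/null_seqP; have : (fun n => (3 / 4 : R) ^+ n) @ \oo --> (0 : R).
  by apply: cvg_expr; rewrite ger0_norm; lra.
apply: cvg_trans; apply: near_eq_cvg; exists 2 => // n /= n2.
by rewrite ltnNge n2.
Qed.
Definition slow : c0 R := C0 slow_null.

(** Adding [basis 0] sets coordinate 0 to 1, so that [perturb] adds exactly [second_blocks]; the
    shift kills it in one step. *)
Definition dfhc_vector : c0 R := basis 0 + first_blocks.

Lemma iter_dfhc_vector n : (0 < n)%N ->
  iter n (@bshift R) dfhc_vector = iter n (@bshift R) first_blocks.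
Proof.
move=> n0; apply: c0_ext => j; rewrite !iter_bshiftE c0E /= addn_eq0 gtn_eqF//=.
by rewrite add0r.
Qed.

Lemma blocks_small (i : nat) : (i < 2)%N -> first_blocks i = 0 /\ second_blocks i = 0.
Proof. by move=> i2; rewrite /= /concat i2. Qed.

(** Induction from 2, since [2 * n.+1 <= 3 * n] requires [2 <= n]. *)
Lemma muln_exp2_le_exp3 n : (n * 2 ^ n <= 3 ^ n)%N.
Proof.
case: n => // -[//|]; elim=> // n; rewrite !(expnS _ n.+2); nia.
Qed.

Lemma positive_lower_bound (f : nat -> R) K :
  (forall n, 0 < f n) -> (forall n, (K <= n)%N -> 1 <= f n) ->
  exists2 c, 0 < c & forall n, c <= f n.
Proof.
move=> f0 fK.
have [c c0 cf] : exists2 c, 0 < c & forall n, (n < K)%N -> c <= f n.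
  elim: K {fK} => [|K [c c0 cf]]; first by exists 1.
  exists (Num.min c (f K)); first by rewrite lt_min c0 f0.
  move=> n; rewrite ltnS leq_eqVlt => /predU1P[->|nK]; first by rewrite ge_min lexx orbT.
  by rewrite ge_min cf.
exists (Num.min c 1); first by rewrite lt_min c0 ltr01.
by move=> n; rewrite ge_min; case: (ltnP n K) => [/cf->//|/fK->]; rewrite orbT.
Qed.

(** Coordinate 0 of the [n]-th iterate is [v 1 * 3 ^+ n] plus a term of size at most
    [|v 0| * 2 ^+ n], so the first dominates for large [n]. The finitely many earlier norms only
    have to be nonzero. *)
Lemma iter_slow_norm_ge (v : c0 R) : v 1 != 0 ->
  exists2 c, 0 < c & forall n,
    c <= `|iter n (@bshift R) (v 0 *: second_blocks + v 1 *: slow)|.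
Proof.
move=> v1; set z := _ + _.
have vp : 0 < `|v 1| by rewrite normr_gt0.
(* For [n >= g], [|v 1| * 3 ^+ n >= |v 1| * n * 2 ^+ n >= (1 + |v 0|) * 2 ^+ n]. *)
pose g := (Num.bound ((1 + `|v 0|) / `|v 1|)).
have zge n : (2 <= n)%N -> (g <= n)%N -> 1 <= `|iter n (@bshift R) z|.
  move=> n2 gn; apply: le_trans (c0_norm_ub _ 0); rewrite iter_bshiftE addn0.
  rewrite c0E !c0E /= ltnNge n2 /= mulrDr.
  have Hs : 4 ^+ n * `|second_blocks n| <= 2 ^+ n.
    rewrite (_ : 2 ^+ n = 4 ^+ n * 2^-1 ^+ n).
      by rewrite ler_wpM2l ?exprn_ge0//; apply: concat_le => *;
        rewrite ?truncate_le// truncate_supp.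
    by rewrite -exprMn; congr (_ ^+ _); lra.
  have E3 : 4 ^+ n * (v 1 * (3 / 4) ^+ n) = v 1 * 3 ^+ n.
    by rewrite mulrCA -exprMn; congr (_ * _ ^+ _); lra.
  rewrite E3 addrC; apply: le_trans (lerB_normD _ _).
  rewrite normrM (ger0_norm (exprn_ge0 _ _))//.
  have -> : `|4 ^+ n * (v 0 * second_blocks n)| = `|v 0| * (4 ^+ n * `|second_blocks n|).
    by rewrite !normrM (ger0_norm (exprn_ge0 _ _))// mulrCA.
  have H3 : n%:R * 2 ^+ n <= 3 ^+ n :> R.
    by rewrite -!natrX -natrM ler_nat; exact: muln_exp2_le_exp3.
  have gv : 1 + `|v 0| <= `|v 1| * n%:R.
    rewrite mulrC -ler_pdivrMr//; apply: le_trans (ltW (archi_boundP _)) _.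
      by rewrite divr_ge0// addr_ge0.
    by rewrite ler_nat.
  have h0 := ler_wpM2l (normr_ge0 (v 0)) Hs.
  have h1 := ler_wpM2l (normr_ge0 (v 1)) H3.
  have h2 : 1 <= 2 ^+ n :> R by rewrite exprn_ege1// ler1n.
  have h3 := ler_wpM2r (exprn_ge0 n (ler0n R 2)) gv.
  rewrite mulrDl mul1r -mulrA in h3.
  lra.
apply: (@positive_lower_bound (fun n => `|iter n (@bshift R) z|) (maxn 2 g))
  => [n|n]; last by rewrite geq_max => /andP[]; exact: zge.
(* If one iterate vanished, so would all later ones, against [zge]. *)
rewrite normr_gt0; apply/eqP => z0.
have := zge (maxn 2 g + n)%N; rewrite iterD z0.
have -> : iter (maxn 2 g) (@bshift R) 0 = 0.
  by apply: c0_ext => j; rewrite iter_bshiftE mulr0.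
rewrite normr0 ler10 => absurd; suff: false by []; apply: absurd.
  exact: leq_trans (leq_maxl 2 g) (leq_addr _ _).
exact: leq_trans (leq_maxr 2 g) (leq_addr _ _).
Qed.

End Vectors.

(** * The conjugated shift *)

Section PairMaps.
Variables (K : numFieldType) (V : normedModType K) (f : V -> V).
Hypothesis fc : continuous f.

Lemma pair_add_continuous : continuous (fun z : V * V => (z.1, f (z.1 + z.2))).
Proof.
move=> z; apply: cvg_pair; first exact: cvg_fst.
apply: (@continuous_comp _ _ _ (fun z : V * V => z.1 + z.2) f); last exact: fc.
exact: add_continuous.
Qed.

Lemma comp_sub_continuous : continuous (fun z : V * V => f z.2 - z.1).
Proof.
move=> z; apply: cvgB; last exact: cvg_fst.
by apply: (@continuous_comp _ _ _ snd f); [exact: cvg_snd|exact: fc].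
Qed.

End PairMaps.

Section Main.
Variable R : realType.

Definition conj_shift : c0 R -> c0 R :=
  perturb (- slow R) (- second_blocks R) \o @bshift R \o
  perturb (slow R) (second_blocks R).

Lemma perturb_cancel : cancel (perturb (slow R) (second_blocks R))
  (perturb (- slow R) (- second_blocks R)).
Proof. by apply: perturbK => //=; apply: (blocks_small R _).2. Qed.

Lemma perturb_cancelN : cancel (perturb (- slow R) (- second_blocks R))
  (perturb (slow R) (second_blocks R)).
Proof.
rewrite -[X in cancel _ (perturb X _)]opprK -[X in cancel _ (perturb _ X)]opprK.
have z i : (i < 2)%N -> (- second_blocks R) i = 0.
  by move=> i2; rewrite c0E (blocks_small R i2).2 oppr0.
by apply: perturbK; rewrite ?z// c0E /= oppr0.
Qed.

Lemma iter_conj_shift n v : iter n conj_shift v =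
  perturb (- slow R) (- second_blocks R)
    (iter n (@bshift R) (perturb (slow R) (second_blocks R) v)).
Proof.
elim: n => [|n IH]; first by rewrite /= perturb_cancel.
by rewrite !iterS IH /conj_shift /= perturb_cancelN.
Qed.

Lemma conj_shift_continuous : continuous conj_shift.
Proof.
move=> x; apply: continuous_comp; first exact: perturb_continuous.
by apply: continuous_comp; [exact: bshift_continuous|exact: perturb_continuous].
Qed.

Lemma iter_bshiftD n (x y : c0 R) :
  iter n (@bshift R) (x + y) = iter n (@bshift R) x + iter n (@bshift R) y.
Proof. by apply: c0_ext => j; rewrite c0E !iter_bshiftE c0E mulrDr. Qed.

Lemma perturb_dfhc_vector : perturb (slow R) (second_blocks R) (dfhc_vector R) =
  dfhc_vector R + second_blocks R.
Proof.
rewrite /perturb /dfhc_vector !c0E !(blocks_small _ _).1//= addr0 scale1r.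
by rewrite add0r scale0r addr0.
Qed.

Lemma bshift_conj_shift_dfhc : d_freq_hypercyclic (@bshift R) conj_shift.
Proof.
exists (dfhc_vector R) => W oW [[a b] Wab].
set S' := perturb (- slow R) (- second_blocks R).
(* [h] undoes the change of variables [(a, b) |-> (a, S b - a)], so it suffices that the orbits of
   [dfhc_vector] and [second_blocks] jointly come near [(a, b')]. *)
pose h (z : c0 R * c0 R) := (z.1, S' (z.1 + z.2)).
pose b' := perturb (slow R) (second_blocks R) b - a.
have hab : h (a, b') = (a, b) by rewrite /h /b' /= addrC subrK /S' perturb_cancel.
have hc : continuous h by exact: pair_add_continuous (@perturb_continuous R _ _).
have : nbhs (a, b') (h @^-1` W).
  by apply: hc; rewrite hab; exact: open_nbhs_nbhs.
move=> /nbhs_ballP[e /= e0 eW].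
have [l lP] := blocks_approx a b' (divr_gt0 e0 (ltr0n R 2)).
(* By [block_le] the position is at most [5 * (2 ^ l * (2 * i + 1) + 1)], hence at most
   [10 * 2 ^ l * i.+1]. *)
apply: (@pos_lower_density_inj _ (fun i => block (2 ^ l * (2 * i + 1))%N) (10 * 2 ^ l)).
- move=> i j /(incn_inj block_mono)/eqP; rewrite eqn_pmul2l ?expn_gt0//.
  by move/eqP; lia.
- move=> i; apply: leq_trans (block_le _) _.
  by have : (0 < 2 ^ l)%N by [rewrite expn_gt0]; nia.
move=> i; have [] := lP _ (ruler_odd_mul l i).
move: (2 ^ l * (2 * i + 1))%N => k ka kb /=.
rewrite iter_conj_shift perturb_dfhc_vector iter_bshiftD.
rewrite iter_dfhc_vector; last by have := block_ge k; lia.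
have e2 : e / 2 < e by rewrite ltr_pdivrMr// ltr_pMr// ltr1n.
apply: (eW (_, _)); split; rewrite /= -ball_normE /= distrC.
  exact: le_lt_trans ka e2.
exact: le_lt_trans kb e2.
Qed.

Lemma not_densely_dhc : ~ densely_d_hypercyclic (@bshift R) conj_shift.
Proof.
move=> dd.
have o1 : open [set v : c0 R | v 1 != 0].
  rewrite (_ : mkset _ = (fun v : c0 R => v 1) @^-1` [set x | x != 0])//.
  by apply: open_comp; [move=> ? _; exact: c0_coord_continuous|exact: open_neq].
have [|v [v1 dv]] := dd _ _ o1.
  by exists (basis R 1) => /=; exact: oner_neq0.
have [c cp cv] := iter_slow_norm_ge v1.
pose S := perturb (slow R) (second_blocks R).
pose h (z : c0 R * c0 R) := S z.2 - z.1.
have hc : continuous h by exact: comp_sub_continuous (@perturb_continuous R _ _).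
(* This preimage is open and contains [(0, 0)], so the joint orbit of [v] would have to enter it. *)
have [||z [zW [n _ nz]]] := dv (h @^-1` ball (0 : c0 R) c).
- have S0 : S 0 - 0 = 0 by rewrite subr0; exact: linear0.
  by exists (0, 0); rewrite /preimage /= /h /= S0; exact: ballxx.
- by apply: open_comp; [move=> *; exact: hc|exact: ball_open].
move: zW; rewrite -nz /= -ball_normE /= sub0r normrN /h /= iter_conj_shift.
(* Along the joint orbit [h] subtracts the [n]-th iterate of [v] from that of [S v], leaving the
   orbit of [v 0 *: second_blocks + v 1 *: slow]. *)
rewrite /S perturb_cancelN {1}/perturb -addrA iter_bshiftD.
by rewrite addrAC subrr add0r ltNge => /negP; apply; exact: cv.
Qed.

End Main.

Theorem theorem7p2 :
  exists (X : completeNormedModType Rdefinitions.R)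
         (T1 T2 : {linear X -> X}),
    continuous T1 /\ continuous T2 /\
    d_freq_hypercyclic T1 T2 /\ ~ densely_d_hypercyclic T1 T2.
Proof.
pose R : realType := Rdefinitions.R.
exists (c0 R : completeNormedModType R), (@bshift R).
exists (perturb (- slow R) (- second_blocks R) \o @bshift R \o
  perturb (slow R) (second_blocks R)).
split; first exact: bshift_continuous.
split; first exact: conj_shift_continuous.
by split; [exact: bshift_conj_shift_dfhc|exact: not_densely_dhc].
Qed.
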